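(* Let $(\mathbf{u},\mathbf{h})$ be an axially symmetric smooth solution, with pressure $p$, of the steady MHD equations $$(\mathbf{u}\cdot\nabla)\mathbf{u}+\nabla p=(\mathbf{h}\cdot\nabla)\mathbf{h}+\Delta\mathbf{u},\quad \operatorname{div}\mathbf{u}=0,\quad (\mathbf{u}\cdot\nabla)\mathbf{h}-(\mathbf{h}\cdot\nabla)\mathbf{u}=\Delta\mathbf{h},\quad \operatorname{div}\mathbf{h}=0\quad\text{in }\mathbb{R}^3,$$ with $\lim_{|\mathbf{x}|\to\infty}\mathbf{u}(\mathbf{x})=\lim_{|\mathbf{x}|\to\infty}\mathbf{h}(\mathbf{x})=\mathbf{0}$, of the form $\mathbf{u}=u_r(r,z)\mathbf{e}_r+u_\theta(r,z)\mathbf{e}_\theta+u_z(r,z)\mathbf{e}_z$, $\mathbf{h}=h_\theta(r,z)\mathbf{e}_\theta$. Let $\Phi=\frac12(|\mathbf{u}|^2+|\mathbf{h}|^2)+p$. Then $$(\mathbf{u}\cdot\nabla)\Phi-\Delta\Phi\le 0 .$$ Hence $\Phi$ satisfies the maximum principle in any bounded domain $D\subset\mathbb{R}^3$: $$\max_{x\in\overline{D}}\Phi(x)\le\max_{x\in\partial D}\Phi(x).$$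
   Context: Cylindrical coordinates: $r=\sqrt{x_1^2+x_2^2}$, $\theta=\arctan(x_2/x_1)$, $z=x_3$, with $\mathbf{e}_r=(\cos\theta,\sin\theta,0)$, $\mathbf{e}_\theta=(-\sin\theta,\cos\theta,0)$, $\mathbf{e}_z=(0,0,1)$. A vector field is axially symmetric if its components in this frame do not depend on $\theta$. $\Phi$ is called the total head pressure. *)

(* Defs.v *)
From HB Require Import structures.
From mathcomp Require Import all_boot all_order all_algebra.
From mathcomp Require Import all_classical all_reals all_analysis.

Set Implicit Arguments.
Unset Strict Implicit.
Unset Printing Implicit Defensive.

Import Order.TTheory GRing.Theory Num.Theory.
Import numFieldNormedType.Exports.

Local Open Scope classical_set_scope.
Local Open Scope ring_scope.

(* R^3 is 'rV[R]_3.  The norm `|_| of 'rV[R]_3 is the sup norm; it is used only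
   through the topology and the notion of bounded set, on which it agrees with
   the Euclidean norm enorm below. *)

Section VectorCalculus.
Variable R : realType.
Implicit Types (f g p : 'rV[R]_3 -> R) (u v w h : 'rV[R]_3 -> 'rV[R]_3).

Definition vec3 (a b c : R) : 'rV[R]_3 := \row_(i < 3) [:: a; b; c]`_i.

Definition dot (x y : 'rV[R]_3) : R := \sum_(i < 3) x 0 i * y 0 i.

Definition enorm (x : 'rV[R]_3) : R := Num.sqrt (dot x x).

Definition component w (i : 'I_3) : 'rV[R]_3 -> R := fun x => w x 0 i.

Definition partial (i : 'I_3) f : 'rV[R]_3 -> R := 'D_(delta_mx 0 i) f.

(* [:: i1; ...; ik] |-> d_i1 (... (d_ik f)) *)
Definition iter_partial (s : seq 'I_3) f : 'rV[R]_3 -> R := foldr partial f s.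

(* C^oo: the iterated partial derivatives of all orders exist everywhere and
   are continuous. *)
Definition smooth f : Prop :=
  forall s : seq 'I_3,
    continuous (iter_partial s f) /\
    forall (i : 'I_3) (x : 'rV[R]_3),
      derivable (iter_partial s f) x (delta_mx 0 i).

Definition smooth_field w : Prop := forall i, smooth (component w i).

Definition grad f : 'rV[R]_3 -> 'rV[R]_3 := fun x => \row_i partial i f x.

Definition divergence w : 'rV[R]_3 -> R :=
  fun x => \sum_(i < 3) partial i (component w i) x.

Definition laplacian f : 'rV[R]_3 -> R :=
  fun x => \sum_(i < 3) partial i (partial i f) x.

Definition vlaplacian w : 'rV[R]_3 -> 'rV[R]_3 :=
  fun x => \row_i laplacian (component w i) x.

(* (v . grad) f *)
Definition advect v f : 'rV[R]_3 -> R :=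
  fun x => \sum_(j < 3) v x 0 j * partial j f x.

(* (v . grad) w *)
Definition vadvect v w : 'rV[R]_3 -> 'rV[R]_3 :=
  fun x => \row_i advect v (component w i) x.

Definition steady_MHD u h p : Prop :=
  forall x : 'rV[R]_3,
    [/\ vadvect u u x + grad p x = vadvect h h x + vlaplacian u x,
        divergence u x = 0,
        vadvect u h x - vadvect h u x = vlaplacian h x &
        divergence h x = 0].

Definition vanishes_at_infinity w : Prop :=
  forall eps : R, 0 < eps ->
    exists M : R, forall x : 'rV[R]_3, M < enorm x -> enorm (w x) < eps.

Definition cyl_point (r theta z : R) : 'rV[R]_3 :=
  vec3 (r * cos theta) (r * sin theta) z.

Definition e_r (theta : R) : 'rV[R]_3 := vec3 (cos theta) (sin theta) 0.
Definition e_theta (theta : R) : 'rV[R]_3 := vec3 (- sin theta) (cos theta) 0.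
Definition e_z : 'rV[R]_3 := vec3 0 0 1.

(* w = wr(r,z) e_r + wt(r,z) e_theta + wz(r,z) e_z, required off the axis r = 0,
   where the frame is undefined. *)
Definition axisymmetric_with w (wr wt wz : R -> R -> R) : Prop :=
  forall r theta z : R, 0 < r ->
    w (cyl_point r theta z) =
      wr r z *: e_r theta + wt r z *: e_theta theta + wz r z *: e_z.

Definition total_head u h p : 'rV[R]_3 -> R :=
  fun x => 2^-1 * (enorm (u x) ^+ 2 + enorm (h x) ^+ 2) + p x.

End VectorCalculus.

Definition boundary (T : topologicalType) (A : set T) : set T :=
  closure A `\` interior A.

(* M = max_{x in A} f x, attainment included. *)
Definition is_max (R : realType) (T : Type) (A : set T) (f : T -> R) (M : R)
    : Prop :=
  (f @` A) M /\ ubound (f @` A) M.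

(* Main.v *)
(** Expanding with the equations, the transport defect of the head pressure is
    [u.grad Phi - lap Phi = h.grad(u.h) - |curl u|^2 - 1/2 |grad h + (grad h)^T|^2],
    where the pressure is eliminated by taking the divergence of the momentum
    equation.  Since [h] points along [e_theta] and [u.h = u_theta h_theta] does
    not depend on [theta], the term [h.grad(u.h)] vanishes off the axis, hence
    everywhere by continuity.  For the maximum principle the drift is bounded on
    the compact closure of [D], so [Phi + eps * exp(l x_0)] with [l] large is a
    strict subsolution, which has no interior maximum; then [eps] tends to 0. *)
Require Import Defs.
From HB Require Import structures.
From mathcomp Require Import all_boot all_order all_algebra.
From mathcomp Require Import all_classical all_reals all_analysis.
From mathcomp Require Import ring lra.
Import Order.TTheory GRing.Theory Num.Theory.
Import numFieldNormedType.Exports.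
Local Open Scope classical_set_scope.
Local Open Scope ring_scope.

(** * Calculus along lines: mean values, mixed derivatives, second-order test *)

Section Lines.
Set Implicit Arguments.
Unset Strict Implicit.
Context {R : realType} {V : normedModType R}.
Implicit Types (f : V -> R) (x v w : V).

Lemma is_derive_line f x v (t : R) : derivable f (x + t *: v) v ->
  is_derive t 1 (fun s => f (x + s *: v)) ('D_v f (x + t *: v)).
Proof.
move=> df.
have E : (fun h : R => h^-1 *: (((fun s => f (x + s *: v)) \o shift t) (h *: 1)
            - f (x + t *: v))) =
         (fun h : R => h^-1 *: ((f \o shift (x + t *: v)) (h *: v) -
                                f (x + t *: v))).
  apply/funext => h /=; congr (_ *: (f _ - _)).
  by rewrite [h *: 1]mulr1 scalerDl addrCA.
by apply: DeriveDef; rewrite /derivable /derive E.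
Qed.

(** Writing the intermediate point with a factor [s] in the open unit interval lets one statement
    serve both signs of [t] and [t = 0]. *)
Lemma MVT_line f x v (t : R) : (forall y, derivable f y v) ->
  exists2 s : R, 0 < s < 1 &
    f (x + t *: v) - f x = t * 'D_v f (x + (s * t) *: v).
Proof.
move=> df; pose g (s : R) := f (x + s *: v).
have dg (s : R) : is_derive s 1 g ('D_v f (x + s *: v)) by exact: is_derive_line.
have cg a b : {within `[a, b], continuous g}.
  apply: continuous_subspaceT => s; apply/differentiable_continuous.
  by apply/derivable1_diffP; have [] := dg s.
have g0 : g 0 = f x by rewrite /g scale0r addr0.
case: (ltrgtP t 0) => [t0|t0|->]; last first.
- by exists 2^-1; [lra|rewrite mul0r scale0r addr0 subrr].
- have [c c0t E] := MVT t0 (fun s _ => dg s) (cg _ _).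
  move: c0t E; rewrite in_itv/= g0 /g subr0 => /andP[c0 ct] E.
  exists (c / t); first by rewrite divr_gt0// ltr_pdivrMr// mul1r.
  by rewrite E divfK ?gt_eqF// mulrC.
- have [c c0t E] := MVT t0 (fun s _ => dg s) (cg _ _).
  move: c0t E; rewrite in_itv/= g0 /g sub0r => /andP[ct c0] E.
  exists (c / t); first by rewrite ltr_ndivlMr// mul0r c0 ltr_ndivrMr// mul1r.
  by rewrite divfK ?lt_eqF//; lra.
Qed.

Lemma continuous_ball f x (e : R) : {for x, continuous f} -> 0 < e ->
  exists2 d : R, 0 < d & forall y, `|y - x| < d -> `|f y - f x| < e.
Proof.
move=> cf e0; have /cvgrPdist_lt/(_ e e0) := cf.
move=> /nbhs_ballP[d /= d0 H]; exists d => // y yx.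
by rewrite distrC; apply: H; rewrite -ball_normE /= distrC.
Qed.

(* Both mixed derivatives are limits of the same second difference quotient. *)
Lemma derive_comm f x v w :
  (forall y, derivable f y v) -> (forall y, derivable f y w) ->
  (forall y, derivable ('D_v f) y w) -> (forall y, derivable ('D_w f) y v) ->
  {for x, continuous ('D_w ('D_v f))} -> {for x, continuous ('D_v ('D_w f))} ->
  'D_w ('D_v f) x = 'D_v ('D_w f) x.
Proof.
move=> dv dw dvw dwv c1 c2.
apply/eqP; rewrite -subr_eq0 -normr_eq0 eq_le normr_ge0 andbT.
apply/ler_addgt0Pl => e e0; rewrite addr0.
have e20 : 0 < e / 2 by rewrite divr_gt0.
have [d1 d10 H1] := continuous_ball c1 e20.
have [d2 d20 H2] := continuous_ball c2 e20.
pose K := `|v| + `|w| + 1.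
have K0 : 0 < K by rewrite /K; have := normr_ge0 v; have := normr_ge0 w; lra.
(* Keeping [t * K] below both radii places the parallelogram with sides [t *: v] and [t *: w] inside
   both balls. *)
pose t := Num.min d1 d2 / (K * 2).
have m0 : 0 < Num.min d1 d2 by rewrite lt_min d10.
have t0 : 0 < t by rewrite divr_gt0 ?mulr_gt0.
have tK : t * K < Num.min d1 d2.
  have -> : t * K = Num.min d1 d2 / 2 by rewrite /t; field; rewrite gt_eqF.
  by rewrite ltr_pdivrMr//; lra.
clearbody t.
have derB z (g : V -> R) (u1 : V) y : (forall y, derivable g y u1) ->
    derivable (fun y => g (y + z)) y u1 /\
    'D_u1 (fun y => g (y + z)) y = 'D_u1 g (y + z).
  move=> dg.
  have E : (fun h : R => h^-1 *: (((fun y => g (y + z)) \o shift y) (h *: u1)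
            - g (y + z))) =
         (fun h : R => h^-1 *: ((g \o shift (y + z)) (h *: u1) - g (y + z))).
    by apply/funext => h /=; rewrite addrA.
  by split; rewrite /derivable /derive E//; exact: dg.
pose S v1 w1 := f (x + t *: v1 + t *: w1) - f (x + t *: v1) -
                (f (x + t *: w1) - f x).
have SC : S v w = S w v.
  rewrite /S [x + t *: w + t *: v]addrAC.
  move: (f (x + t *: v + t *: w)) (f (x + t *: v)) (f (x + t *: w)) => a b c.
  by ring.
(* One mean value step on the increment [g] along [v1], then one on ['D_v1 f] along [w1]; the
   symmetry [SC] makes this serve both orders. *)
have key (v1 w1 : V) : `|v1| + `|w1| + 1 = K ->
    (forall y, derivable f y v1) -> (forall y, derivable ('D_v1 f) y w1) ->
    exists2 y, `|y - x| < Num.min d1 d2 & S v1 w1 = t * (t * 'D_w1 ('D_v1 f) y).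
  move=> EK dv1 dv1w1.
  pose g y := f (y + t *: w1) - f y.
  have dg y : derivable g y v1.
    exact: (derivableB (derB (t *: w1) f v1 y dv1).1 (dv1 y)).
  have Dg y : 'D_v1 g y = 'D_v1 f (y + t *: w1) - 'D_v1 f y.
    have [A B] := derB (t *: w1) f v1 y dv1.
    by have := deriveB A (dv1 y); rewrite B.
  have [a a01 Ea] := MVT_line x t dg.
  have [b b01 Eb] := MVT_line (x + (a * t) *: v1) t dv1w1.
  exists (x + (a * t) *: v1 + (b * t) *: w1); last by move: Ea; rewrite /g Dg Eb.
  move: a01 b01 => /andP[a0 a1] /andP[b0 b1].
  rewrite -[x + _ + _]addrA [X in `|X|]addrC addKr.
  apply: (le_lt_trans (ler_normD _ _)).
  rewrite (normrZ (a * t) v1) (normrZ (b * t) w1).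
  apply: le_lt_trans tK.
  rewrite (ger0_norm (ltW (mulr_gt0 a0 t0))) (ger0_norm (ltW (mulr_gt0 b0 t0))).
  apply: (@le_trans _ _ (t * `|v1| + t * `|w1|)); last first.
    by rewrite -EK !mulrDr mulr1; lra.
  by apply: lerD; apply: ler_wpM2r; rewrite ?normr_ge0// ler_piMl ?ltW.
have [y yx Ey] := key v w erefl dv dvw.
have [z zx Ez] : exists2 z, `|z - x| < Num.min d1 d2 &
    S w v = t * (t * 'D_v ('D_w f) z).
  by apply: key => //; rewrite /K [`|w| + _]addrC.
have {}yx : `|y - x| < d1 by apply: (lt_le_trans yx); rewrite ge_min lexx.
have {}zx : `|z - x| < d2 by apply: (lt_le_trans zx); rewrite ge_min lexx orbT.
have YZ : 'D_w ('D_v f) y = 'D_v ('D_w f) z.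
  apply: (mulfI (lt0r_neq0 t0)); apply: (mulfI (lt0r_neq0 t0)).
  exact: (eq_trans (esym Ey) (eq_trans SC Ez)).
move: (H1 y yx) (H2 z zx); rewrite -YZ.
move: ('D_w ('D_v f) y) ('D_w ('D_v f) x) ('D_v ('D_w f) x) => a b c.
rewrite !ltr_norml ler_norml.
move=> /andP[h1 h2] /andP[h3 h4]; clear -h1 h2 h3 h4.
by apply/andP; split; lra.
Qed.

(** Fermat's theorem gives the first claim. Were the second derivative positive, two mean value
    steps would put [f] above [f c] near [c]. *)
Lemma derive_line_max f c v (d : R) :
  (forall y, derivable f y v) -> (forall y, derivable ('D_v f) y v) ->
  {for c, continuous ('D_v ('D_v f))} ->
  0 < d -> (forall t, `|t| < d -> f (c + t *: v) <= f c) ->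
  'D_v f c = 0 /\ 'D_v ('D_v f) c <= 0.
Proof.
move=> df ddf cddf d0 fmax.
have D0 : 'D_v f c = 0.
  have := @derive1_at_max R (fun s => f (c + s *: v)) (- d) d 0.
  have dl s := is_derive_line (df (c + s *: v)).
  case=> [|t _||t|_]; first lra.
  - by have [] := dl t.
  - by rewrite in_itv/= oppr_lt0 d0.
  - by rewrite in_itv/= -ltr_norml scale0r addr0 => /fmax.
  - by have [_ ->] := dl 0; rewrite scale0r addr0.
split=> //; rewrite leNgt; apply/negP => pos.
have [e e0 He] := continuous_ball cddf pos.
(* The first bound stays in the range of the maximality hypothesis, the second within distance [e]
   of [c], where the second derivative is positive; the added 1 allows for [v = 0]. *)
pose t : R := Num.min (d / 2) (e / 2 / (`|v| + 1)).
have v1 : 0 < `|v| + 1 by rewrite ltr_wpDl.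
have t0 : 0 < t by rewrite lt_min !divr_gt0.
have td : `|t| < d.
  by rewrite gtr0_norm// gt_min (_ : d / 2 < d)//; clear -d0; lra.
have tve : t * `|v| < e.
  apply: (@le_lt_trans _ _ (e / 2)); last by rewrite ltr_pdivrMr// ltr_pMr// ltr1n.
  apply: (@le_trans _ _ (e / 2 / (`|v| + 1) * `|v|)).
    by rewrite ler_wpM2r// ge_min lexx orbT.
  by rewrite -mulrA ler_piMr ?divr_ge0 ?ltW// mulrC ltr_pdivrMr// mul1r ltrDl.
have [s /andP[s0 s1] Es] := MVT_line c t df.
have [r /andP[r0 r1] Er] := MVT_line c (s * t) ddf.
have : 0 < 'D_v ('D_v f) (c + (r * (s * t)) *: v).
  have /He : `|c + (r * (s * t)) *: v - c| < e.
    rewrite [c + _]addrC addrK normrZ gtr0_norm ?mulr_gt0//.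
    apply: le_lt_trans tve; rewrite ler_wpM2r// mulrA ler_piMl ?(ltW t0)//.
    by apply: mulr_ile1; exact: ltW.
  by rewrite distrC ltr_norml => /andP[_]; rewrite ltrBlDl ltrDr.
move: Er; rewrite D0 subr0 => Er D2.
have := fmax t td; rewrite -subr_le0 Es leNgt => /negP; apply.
by rewrite mulr_gt0// Er mulr_gt0// mulr_gt0.
Qed.

(* The chain rule is replaced by two mean value steps from [x] to [x + a v] and
   from there to [x + a v + b w]. *)
Lemma derive_const_curve f x v w (a b : R -> R) :
  (forall y, derivable f y v) -> (forall y, derivable f y w) ->
  {for x, continuous ('D_v f)} -> {for x, continuous ('D_w f)} ->
  derivable a 0 1 -> derivable b 0 1 -> a 0 = 0 -> b 0 = 0 ->
  (forall t, f (x + a t *: v + b t *: w) = f x) ->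
  'D_1 a 0 * 'D_v f x + 'D_1 b 0 * 'D_w f x = 0.
Proof.
move=> dv dw cv cw da db a0 b0 fconst.
have quot (c : R -> R) : derivable c 0 1 -> c 0 = 0 ->
    (fun t : R => t^-1 * c t) @ 0^' --> 'D_1 c 0.
  move=> dc c0.
  have := dc; rewrite /derivable => /cvgP; rewrite -/(derive c 0 1).
  apply: cvg_trans; apply: near_eq_cvg; near=> t => /=.
  by rewrite c0 subr0 addr0 [t *: 1]mulr1.
have cvg0 (c : R -> R) : derivable c 0 1 -> c 0 = 0 -> c @ 0^' --> (0 : R).
  move=> dc c0; rewrite -[X in _ --> X]c0; apply: cvg_within_filter.
  exact/differentiable_continuous/derivable1_diffP.
have small (c s : R -> R) : derivable c 0 1 -> c 0 = 0 ->
    (forall t, 0 < s t < 1) -> (fun t : R => s t * c t) @ 0^' --> (0 : R).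
  move=> dc c0 s01.
  have cc := cvg0 c dc c0.
  apply/cvgr0Pnorm_lt => e e0; near=> t.
  apply: (@le_lt_trans _ _ `|c t|); last first.
    by near: t; exact: (cvgr0_norm_lt c cc).
  have /andP[s0 s1] := s01 t.
  by rewrite normrM ler_piMl// gtr0_norm// ltW.
(* The intermediate points depend on [t]; choice turns them into functions of [t], so that limits
   can be taken. *)
have [t|s1 Hs1] := @choice R R (fun t s => 0 < s < 1 /\
    f (x + a t *: v) - f x = a t * 'D_v f (x + (s * a t) *: v)).
  by have [s] := MVT_line x (a t) dv; exists s.
have [t|s2 Hs2] := @choice R R (fun t s => 0 < s < 1 /\
    f (x + a t *: v + b t *: w) - f (x + a t *: v) =
    b t * 'D_w f (x + a t *: v + (s * b t) *: w)).
  by have [s] := MVT_line (x + a t *: v) (b t) dw; exists s.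
pose A t := 'D_v f (x + (s1 t * a t) *: v).
pose B t := 'D_w f (x + a t *: v + (s2 t * b t) *: w).
have line (z : R -> V) (c : R -> R) v1 : z @ 0^' --> x ->
    c @ 0^' --> (0 : R) -> (fun t => z t + c t *: v1) @ 0^' --> x.
  move=> zx c0; rewrite -[X in _ --> X]addr0 -(scale0r v1).
  by apply: (cvgD zx); exact: cvgZr_tmp.
have cA : A @ 0^' --> 'D_v f x.
  apply: (cvg_comp (fun t => x + (s1 t * a t) *: v) ('D_v f) _ cv).
  apply: line; first exact: cvg_cst.
  by apply: small => // t; have [] := Hs1 t.
have cB : B @ 0^' --> 'D_w f x.
  apply: (cvg_comp (fun t => x + a t *: v + (s2 t * b t) *: w) ('D_w f) _ cw).
  apply: (line _ _ w); last by apply: small => // t; have [] := Hs2 t.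
  apply: line; first exact: cvg_cst.
  exact: cvg0.
have lim1 := cvgD (cvgM (quot a da a0) cA) (cvgM (quot b db b0) cB).
(* The two increments telescope to [f] on the curve minus [f x], so the quotient is identically
   zero. *)
have E : (fun t : R => t^-1 * a t * A t + t^-1 * b t * B t) = cst 0.
  apply/funext => t; rewrite -!mulrA -mulrDr.
  have [_ <-] := Hs1 t; have [_ <-] := Hs2 t.
  by rewrite fconst addrC subrKA subrr mulr0.
rewrite -(cvg_lim (@Rhausdorff R) (lim1 _ _ _)) [X in X @ _](_ : _ = cst 0)//.
exact: lim_cst.
Unshelve. all: by end_near. Qed.

End Lines.

(** * Algebra of smooth functions and their partial derivatives *)

Section Smooth.
Set Implicit Arguments.
Unset Strict Implicit.
Context {R : realType}.
Implicit Types (f g : 'rV[R]_3 -> R) (x : 'rV[R]_3) (c : R) (i j : 'I_3).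

Lemma smooth_continuous f : smooth f -> continuous f.
Proof. by move=> sf; have [] := sf [::]. Qed.

Lemma smooth_derivable f i x : smooth f -> derivable f x (delta_mx 0 i).
Proof. by move=> sf; have [_] := sf [::]; apply. Qed.

Lemma smooth_partial f i : smooth f -> smooth (partial i f).
Proof.
move=> sf s; have := sf (rcons s i).
by rewrite /iter_partial foldr_rcons.
Qed.

(** A hypothesis weak enough for the sum and product rules to apply before sums and products are
    known to be smooth. *)
Let e_derivable f := forall i x, derivable f x (delta_mx 0 i).

Let partialDE f g i : e_derivable f -> e_derivable g ->
  partial i (fun x => f x + g x) = fun x => partial i f x + partial i g x.
Proof. by move=> df dg; apply/funext => x; exact: deriveD. Qed.

Let partialME f g i : e_derivable f -> e_derivable g ->
  partial i (fun x => f x * g x) =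
  fun x => f x * partial i g x + partial i f x * g x.
Proof.
move=> df dg; apply/funext => x; rewrite /partial [LHS]deriveM//.
by congr (_ + _); rewrite mulrC.
Qed.

Lemma partial_cst c i : partial i (fun=> c) = fun=> 0 :> R.
Proof. by apply/funext => x; exact: derive_cst. Qed.

(** Along [delta_mx 0 j] the function is [expR] of an affine function of one variable, of slope [c]
    if [i = j] and 0 otherwise. *)
Lemma is_derive_exp_coord c i j x :
  is_derive x (delta_mx 0 j) (fun y : 'rV[R]_3 => expR (c * y 0 i))
    ((i == j)%:R * c * expR (c * x 0 i)).
Proof.
have E (h : R) : c * (h *: delta_mx 0 j + x) 0 i =
    (h * (c * (i == j)%:R) + c * x 0 i).
  by rewrite !mxE eqxx/=; ring.
pose k := c * (i == j)%:R.
have d1 : is_derive (0:R) 1 (fun h : R => h * k + c * x 0 i) k.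
  have -> : (fun h : R => h * k + c * x 0 i) = k \*: id + cst (c * x 0 i).
    by apply/funext => h /=; rewrite mulrC.
  by apply: is_derive_eq; rewrite addr0 [LHS]mulr1.
have d2 := is_derive1_comp (is_derive_expR _) d1.
have F : (fun h : R => expR (c * (h *: delta_mx 0 j + x) 0 i)) =
    expR \o (fun h : R => h * k + c * x 0 i).
  by apply/funext => h; rewrite E.
have [d3 d4] := d2.
apply: DeriveDef; first by apply: (derivable1P _ _ _).2; rewrite F.
transitivity ('D_1 (expR \o (fun h : R => h * k + c * x 0 i)) 0); last first.
  by rewrite d4 mul0r add0r /k; ring.
rewrite -F /derive; congr (lim (_ @ 0^')); apply/funext => h /=.
by rewrite addr0 [h *: 1]mulr1 scale0r add0r.
Qed.

Lemma partial_exp_coord c i j :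
  partial j (fun y : 'rV[R]_3 => expR (c * y 0 i)) =
  fun x => (i == j)%:R * c * expR (c * x 0 i).
Proof. by apply/funext => x; have [] := is_derive_exp_coord c i j x. Qed.

(* The closure of smooth functions under the ring operations and [expR] of a
   linear coordinate is stable under [partial], whence smoothness of its
   members. *)
Inductive smooth_closure : ('rV[R]_3 -> R) -> Prop :=
| closure_smooth f of smooth f : smooth_closure f
| closure_cst c : smooth_closure (fun=> c)
| closure_exp c i : smooth_closure (fun x => expR (c * x 0 i))
| closure_add f g of smooth_closure f & smooth_closure g :
    smooth_closure (fun x => f x + g x)
| closure_mul f g of smooth_closure f & smooth_closure g :
    smooth_closure (fun x => f x * g x).

Lemma smooth_closureP f : smooth_closure f ->
  [/\ continuous f, e_derivable f & forall i, smooth_closure (partial i f)].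
Proof.
elim=> {f} [f sf|c|c i|f g _ [cf df pf] _ [cg dg pg]|f g Cf [cf df pf] Cg [cg dg pg]].
- split; first exact: smooth_continuous.
  + by move=> i x; exact: smooth_derivable.
  + by move=> i; apply/closure_smooth/smooth_partial.
- split; first exact: cst_continuous.
  + by move=> i x; exact: derivable_cst.
  + by move=> i; rewrite partial_cst; exact: closure_cst.
- split.
  + have cl : continuous (fun y : 'rV[R]_3 => c * y 0 i).
      move=> y; apply: continuousM; first exact: cst_continuous.
      exact: coord_continuous.
    by move=> x; apply: (continuous_comp (cl x)); exact: continuous_expR.
  + by move=> j x; have [] := is_derive_exp_coord c i j x.
  + move=> j; rewrite partial_exp_coord.
    by apply: closure_mul; [exact: closure_cst|exact: closure_exp].
- split; first by move=> x; exact: (continuousD (cf x) (cg x)).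
  + by move=> i x; apply: derivableD.
  + by move=> i; rewrite partialDE//; exact: closure_add.
- split; first by move=> x; exact: (continuousM (cf x) (cg x)).
  + by move=> i x; apply: derivableM.
  + by move=> i; rewrite partialME//; apply: closure_add; exact: closure_mul.
Qed.

Lemma smooth_closure_smooth f : smooth_closure f -> smooth f.
Proof.
(* The innermost derivative is the last entry of [s], hence the induction from the right with [f]
   general. *)
move=> cf s; elim/last_ind: s f cf => [|s i IH] f /smooth_closureP[cf df pf].
  by [].
by rewrite /iter_partial foldr_rcons; exact: IH.
Qed.

Lemma smooth_cst c : smooth (fun=> c : R).
Proof. by apply: smooth_closure_smooth; constructor. Qed.

Lemma smooth_exp_coord c i : smooth (fun x => expR (c * x 0 i)).
Proof. by apply: smooth_closure_smooth; constructor. Qed.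

Lemma smoothD f g : smooth f -> smooth g -> smooth (fun x => f x + g x).
Proof. by move=> ? ?; apply/smooth_closure_smooth/closure_add; constructor. Qed.

Lemma smoothM f g : smooth f -> smooth g -> smooth (fun x => f x * g x).
Proof. by move=> ? ?; apply/smooth_closure_smooth/closure_mul; constructor. Qed.

Lemma smoothZ c f : smooth f -> smooth (fun x => c * f x).
Proof. exact: (smoothM (smooth_cst c)). Qed.

Lemma smooth_sum n (F : 'I_n -> 'rV[R]_3 -> R) :
  (forall k, smooth (F k)) -> smooth (fun x => \sum_(j < n) F j x).
Proof.
move=> sF; elim: n F sF => [|n IH] F sF.
  by under eq_fun do rewrite big_ord0; exact: smooth_cst.
by under eq_fun do rewrite big_ord_recr; apply: smoothD => //; exact: IH.
Qed.

Lemma partialD f g i x : smooth f -> smooth g ->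
  partial i (fun x => f x + g x) x = partial i f x + partial i g x.
Proof. by move=> sf sg; rewrite partialDE// => j y; exact: smooth_derivable. Qed.

Lemma partialM f g i x : smooth f -> smooth g ->
  partial i (fun x => f x * g x) x = f x * partial i g x + partial i f x * g x.
Proof. by move=> sf sg; rewrite partialME// => j y; exact: smooth_derivable. Qed.

Lemma partialZ c f i x : smooth f ->
  partial i (fun x => c * f x) x = c * partial i f x.
Proof.
move=> sf; rewrite (partialM i x (smooth_cst c) sf).
by rewrite partial_cst mul0r addr0.
Qed.

Lemma partial_sum n (F : 'I_n -> 'rV[R]_3 -> R) i : (forall k, smooth (F k)) ->
  partial i (fun x => \sum_(j < n) F j x) = fun x => \sum_(j < n) partial i (F j) x.
Proof.
move=> sF; elim: n F sF => [|n IH] F sF; apply/funext => x.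
  by rewrite big_ord0; under eq_fun do rewrite big_ord0; rewrite partial_cst.
rewrite big_ord_recr; under eq_fun do rewrite big_ord_recr.
by rewrite partialD ?IH//; exact: smooth_sum.
Qed.

Lemma partialC f i j : smooth f -> partial i (partial j f) = partial j (partial i f).
Proof.
move=> sf; apply/funext => x; apply: derive_comm => [y|y|y|y||].
- exact: smooth_derivable.
- exact: smooth_derivable.
- exact/smooth_derivable/smooth_partial.
- exact/smooth_derivable/smooth_partial.
- exact/smooth_continuous/smooth_partial/smooth_partial.
- exact/smooth_continuous/smooth_partial/smooth_partial.
Qed.

End Smooth.

(** * Sums over three indices and the pointwise algebra *)

Section Sum3.
Set Implicit Arguments.
Unset Strict Implicit.
Context {R : realType}.

Lemma sum3E (F : 'I_3 -> R) : \sum_(i < 3) F i = F 0 + F 1 + F 2.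
Proof.
rewrite !big_ord_recl big_ord0 addr0 addrA.
by congr (_ + _ + _); congr F; apply: val_inj.
Qed.

Lemma ord3P (P : 'I_3 -> Prop) : P 0 -> P 1 -> P 2 -> forall i, P i.
Proof.
move=> P0 P1 P2 [[|[|[|//]]] i3].
- by rewrite (_ : Ordinal i3 = 0)//; exact: val_inj.
- by rewrite (_ : Ordinal i3 = 1)//; exact: val_inj.
- by rewrite (_ : Ordinal i3 = 2)//; exact: val_inj.
Qed.

(** [a], [b], [P] stand for the values of [u], [h], [grad p] at a point, and [U k j], [H k j] for
    the [k]-th partial of the [j]-th component. The subtracted bracket is the Laplacian of the head
    pressure once the equations have eliminated those of [u], [h] and [p]. *)
Lemma head_algebra (a b P : 'I_3 -> R) (U H : 'I_3 -> 'I_3 -> R) :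
  \sum_i a i * (\sum_(j < 3) (a j * U i j + b j * H i j) + P i) -
  (\sum_i (a i * (\sum_(j < 3) a j * U j i + P i - \sum_(j < 3) b j * H j i) +
            b i * (\sum_(j < 3) a j * H j i - \sum_(j < 3) b j * U j i)) +
   \sum_(k < 3) \sum_(j < 3) (U k j ^+ 2 + H k j ^+ 2) +
   \sum_(k < 3) \sum_(j < 3) (H k j * H j k - U k j * U j k)) =
  \sum_i b i * \sum_(j < 3) (a j * H i j + U i j * b j) -
  2^-1 * \sum_(k < 3) \sum_(j < 3)
    ((U k j - U j k) ^+ 2 + (H k j + H j k) ^+ 2).
Proof. by rewrite !sum3E; field. Qed.

End Sum3.

(** * Weak maximum principle for a Laplacian with drift *)

Section MaximumPrinciple.
Set Implicit Arguments.
Unset Strict Implicit.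
Context {R : realType}.
Implicit Types (f : 'rV[R]_3 -> R) (D : set 'rV[R]_3).

Lemma interior_max f D z : smooth f -> open D -> D z ->
  (forall y, D y -> f y <= f z) ->
  forall i, partial i f z = 0 /\ partial i (partial i f) z <= 0.
Proof.
move=> sf oD Dz fmax i.
have /nbhs_ballP[d /= d0 dD] : nbhs z D by exact: open_nbhs_nbhs.
pose e := d / (`|delta_mx 0 i : 'rV[R]_3| + 1).
have n1 : 0 < `|delta_mx 0 i : 'rV[R]_3| + 1 by rewrite ltr_wpDl.
apply: (derive_line_max (d := e)).
- by move=> y; exact: smooth_derivable.
- by move=> y; exact/smooth_derivable/smooth_partial.
- exact/smooth_continuous/smooth_partial/smooth_partial.
- by rewrite divr_gt0.
- move=> t te; apply/fmax/dD; rewrite -ball_normE /= opprD addNKr normrN.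
  rewrite (normrZ t); move: te; rewrite /e ltr_pdivlMr//; apply: le_lt_trans.
  by rewrite ler_wpM2l// lerDl.
Qed.

Lemma closed_boundary D : closed (boundary D).
Proof.
apply: closedI; first exact: closed_closure.
exact/open_closedC/open_interior.
Qed.

Lemma bounded_closure D : bounded_set D -> bounded_set (closure D).
Proof.
move=> [M [Mr bD]]; exists (M + 1); split; first by rewrite realD.
move=> N MN x clx; apply: (@le_trans _ _ (M + 1 / 2 + 1 / 2)); last first.
  by rewrite -addrA -splitr ltW.
(* One half pays for moving from [x] to a point of [D], the other for the strict inequality in
   [bounded_set]. *)
have [y [Dy xy]] := clx _ (nbhsx_ballx x (1 / 2 : R) ltac:(by rewrite divr_gt0)).
have yM : `|y| <= M + 1 / 2 by apply: bD Dy; rewrite ltrDl divr_gt0.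
rewrite -(subrK y x); apply: (le_trans (ler_normD _ _)); rewrite addrC lerD//.
by move: xy; rewrite -ball_normE /= => /ltW.
Qed.

(* Adding [eps * expR (l * x_0)] with [l] above the first component of the drift
   makes the differential inequality strict. *)
Lemma weak_maximum_principle (b : 'rV[R]_3 -> 'rV[R]_3) f D :
  smooth f -> continuous (component b 0) ->
  (forall x, advect b f x - laplacian f x <= 0) ->
  open D -> D !=set0 -> bounded_set D ->
  exists MD MdD : R,
    [/\ is_max (closure D) f MD, is_max (boundary D) f MdD & MD <= MdD].
Proof.
move=> sf cb sub oD D0 bD.
have cK : compact (closure D).
  by apply: bounded_closed_compact; [exact: bounded_closure|exact: closed_closure].
have K0 : closure D !=set0 by case: D0 => y Dy; exists y; exact: subset_closure.
have cdD : compact (boundary D).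
  by apply: (subclosed_compact (@closed_boundary D) cK) => y [].
have maxE (A : set 'rV[R]_3) (g : 'rV[R]_3 -> R) : A !=set0 -> compact A ->
    continuous g -> exists2 z, A z & forall y, A y -> g y <= g z.
  move=> A0 cA cg.
  have [z /set_mem Az zmax] := EVT_max_rV A0 cA (continuous_subspaceT cg).
  by exists z => // y Ay; apply/zmax/mem_set.
have [zb Kzb bmax] := maxE _ _ K0 cK cb.
(* The maximum of the first drift component on the closure, truncated at 0 and raised by 1: positive
   and strictly above the drift. *)
pose l := Num.max (component b 0 zb) 0 + 1.
have l0 : 0 < l by rewrite ltr_wpDl// le_max lexx orbT.
have bl x : closure D x -> b x 0 0 < l.
  move=> Kx; apply: (le_lt_trans (bmax x Kx)).
  by rewrite (@le_lt_trans _ _ (Num.max (component b 0 zb) 0)) ?le_max ?lexx// ltrDl.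
(* The factor by which [partial i] multiplies the exponential [w]; it is nonzero only in direction
   0. *)
pose c (i : 'I_3) := (0 == i)%:R * l.
have [w [sw wgt0 Dw]] : exists w : 'rV[R]_3 -> R, [/\ smooth w,
    forall x, 0 < w x & forall i, partial i w = fun x => c i * w x].
  exists (fun x => expR (l * x 0 0)); split; first exact: smooth_exp_coord.
  + by move=> x; exact: expR_gt0.
  + by move=> i; exact: partial_exp_coord.
have [zw Kzw wmax] := maxE _ _ K0 cK (smooth_continuous sw).
have [zK KzK fmax] := maxE _ _ K0 cK (smooth_continuous sf).
(* Compactness gives a maximiser on the closure. If it lay in [D], the first and second order
   conditions there would contradict [sub]. *)
have perturbed (eps : R) : 0 < eps -> exists2 z, boundary D z &
    forall y, closure D y -> f y + eps * w y <= f z + eps * w z.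
  move=> eps0; pose v x := f x + eps * w x.
  have sv : smooth v := smoothD sf (smoothZ eps sw).
  have [z Kz vmax] := maxE _ _ K0 cK (smooth_continuous sv).
  exists z => //; split => //.
  rewrite (_ : interior D = D); last exact/interior_id.
  move=> Dz.
  have crit := interior_max sv oD Dz (fun y Dy => vmax y (subset_closure Dy)).
  have Dv i : partial i v = fun x => partial i f x + eps * partial i w x.
    apply/funext => x.
    by rewrite (partialD i x sf (smoothZ eps sw)) (partialZ eps i x sw).
  have DDv i : partial i (partial i v) z =
      partial i (partial i f) z + eps * (c i * (c i * w z)).
    have spf := smooth_partial i sf; have spw := smooth_partial i sw.
    rewrite Dv (partialD i z spf (smoothZ eps spw)) (partialZ eps i z spw).
    by rewrite [in partial i (partial i w)]Dw (partialZ _ i z sw) Dw.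
  have := sub z; rewrite leNgt => /negP; apply.
  have [c0 c1 c2] : [/\ c 0 = l, c 1 = 0 & c 2 = 0].
    by rewrite /c; split; rewrite ?mul1r ?mul0r.
  have [] := crit 0; have [] := crit 1; have [] := crit 2.
  rewrite !DDv !Dv !Dw /advect /laplacian !sum3E c0 c1 c2.
  move: (wgt0 z) (bl z Kz); clear -l0 eps0.
  move: (partial 0 (partial 0 f) z) (partial 1 (partial 1 f) z)
    (partial 2 (partial 2 f) z) (partial 0 f z) (partial 1 f z) (partial 2 f z)
    (b z 0 0) (b z 0 1) (b z 0 2) (w z) => a00 a11 a22 a0 a1 a2 b0 b1 b2 W.
  move=> W0 bl0; rewrite !(mul0r, mulr0, addr0) => -> a22_le -> a11_le a0E a00_le.
  rewrite !mulr0 !addr0 (_ : a0 = - (eps * (l * W))); last by lra.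
  (* At an interior maximiser this quantity would be a lower bound for the transport defect of
     [f]. *)
  have : 0 < eps * W * (l * (l - b0)) by rewrite !mulr_gt0 ?subr_gt0.
  by nra.
(* Used only to see that the boundary is nonempty, so that [f] attains a maximum on it. *)
have [z1 dDz1 _] := perturbed 1 ltr01.
have [zd dDzd dmax] :=
  maxE _ _ (ex_intro _ z1 dDz1) cdD (smooth_continuous sf).
exists (f zK), (f zd); split.
- by split; [exists zK|move=> _ [y Ky <-]; exact: fmax].
- by split; [exists zd|move=> _ [y Ky <-]; exact: dmax].
apply/ler_addgt0Pl => e e0.
have w0 := wgt0 zw.
(* Dividing by the maximum of [w] on the closure keeps the perturbation at most [e] there. *)
have [z dDz zmax] := perturbed (e / w zw) (divr_gt0 e0 w0).
have h1 := zmax zK KzK.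
have h2 : e / w zw * w z <= e.
  rewrite -[leRHS](divfK (lt0r_neq0 w0)) ler_wpM2l ?divr_ge0 ?(ltW e0) ?(ltW w0)//.
  by apply: wmax; case: dDz.
have h3 : 0 <= e / w zw * w zK by apply: mulr_ge0; rewrite ?divr_ge0// ltW.
have h4 := dmax z dDz.
move: h1 h2 h3 h4; clear.
by move: (_ * w zK) (_ * w z) => A B; lra.
Qed.

End MaximumPrinciple.

(** * Polar coordinates and the angular derivative *)

Section Axisymmetry.
Set Implicit Arguments.
Unset Strict Implicit.
Context {R : realType}.
Implicit Types (g : 'rV[R]_3 -> R) (x : 'rV[R]_3).

(** [acos (a / r)] has the right cosine and a nonnegative sine, which is [|b| / r]; the sign of [b]
    then decides the sign of the angle. *)
Lemma polarP (a b : R) : a ^+ 2 + b ^+ 2 != 0 ->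
  exists r theta : R, [/\ 0 < r, a = r * cos theta & b = r * sin theta].
Proof.
move=> ab0; pose r := Num.sqrt (a ^+ 2 + b ^+ 2).
have r2 : r ^+ 2 = a ^+ 2 + b ^+ 2 by rewrite sqr_sqrtr// addr_ge0 ?sqr_ge0.
have r0 : 0 < r by rewrite sqrtr_gt0 lt_neqAle eq_sym ab0 addr_ge0 ?sqr_ge0.
have rn0 : r != 0 by rewrite gt_eqF.
have ar : -1 <= a / r <= 1.
  rewrite -ler_norml normrM normfV (gtr0_norm r0) ler_pdivrMr// mul1r.
  rewrite -(gtr0_norm r0) -ler_sqr ?nnegrE// !real_normK ?num_real// r2.
  by rewrite lerDl sqr_ge0.
have ca : a = r * cos (acos (a / r)) by rewrite acosK ?in_itv//; field.
have sb : `|b| = r * sin (acos (a / r)).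
  rewrite sin_acos// (_ : 1 - _ = (b / r) ^+ 2); last first.
    by rewrite !expr_div_n; field: r2; rewrite rn0.
  by rewrite sqrtr_sqr normrM normfV (gtr0_norm r0); field.
case: (lerP 0 b) => b0.
- by exists r, (acos (a / r)); split=> //; rewrite -sb ger0_norm.
- exists r, (- acos (a / r)); split=> //; first by rewrite cosN.
  by rewrite sinN mulrN -sb ltr0_norm ?opprK.
Qed.

(** With [f] the cosine or sine, this is a coordinate of the displacement of a point turning on a
    circle of radius [r]; it vanishes at [s = 0], as [derive_const_curve] requires. *)
Lemma derive_trig_shift (f : R -> R) (df r t : R) : is_derive t 1 f df ->
  derivable (fun s => r * (f (t + s) - f t)) 0 1 /\
  'D_1 (fun s => r * (f (t + s) - f t)) 0 = r * df.
Proof.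
move=> dft.
have d1 : is_derive (0 : R) 1 (fun s : R => t + s) 1.
  have -> : (fun s : R => t + s) = cst t + id by [].
  by apply: is_derive_eq; rewrite add0r.
have dft0 : is_derive (t + 0) 1 f df by rewrite addr0.
have d2 : is_derive (0 : R) 1 (fun s : R => f (t + s)) (df * 1).
  exact: (is_derive1_comp dft0 d1).
have d3 : is_derive (0 : R) 1 (fun s => r * (f (t + s) - f t)) (r * df).
  have -> : (fun s => r * (f (t + s) - f t)) =
      r \*: ((fun s : R => f (t + s)) - cst (f t)) by [].
  by apply: is_derive_eq; rewrite subr0 mulr1.
by have [] := d3.
Qed.

(** The coefficients are the velocity of [cyl_point r t z] in [t], tangent to a circle on which [g]
    is constant. *)
Lemma rotation_derivative g (r theta z : R) : smooth g ->
  (forall t, g (cyl_point r t z) = g (cyl_point r theta z)) ->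
  - (r * sin theta) * partial 0 g (cyl_point r theta z) +
  r * cos theta * partial 1 g (cyl_point r theta z) = 0.
Proof.
move=> sg gconst.
have [da Da] := derive_trig_shift r (is_derive_cos theta).
have [db Db] := derive_trig_shift r (is_derive_sin theta).
rewrite -mulrN -Da -Db.
apply: (derive_const_curve (v := delta_mx 0 0) (w := delta_mx 0 1) _ _ _ _ da db).
- by move=> y; exact: smooth_derivable.
- by move=> y; exact: smooth_derivable.
- exact/smooth_continuous/smooth_partial.
- exact/smooth_continuous/smooth_partial.
- by rewrite addr0 subrr mulr0.
- by rewrite addr0 subrr mulr0.
move=> t; rewrite -(gconst (theta + t)); congr g.
apply/rowP; apply: ord3P; rewrite !mxE /=; ring.
Qed.

(** Cartesian form of the angular derivative: the direction is [r *: e_theta], written without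
    choosing an angle. *)
Lemma e_theta_derivative g x : smooth g -> x 0 0 ^+ 2 + x 0 1 ^+ 2 != 0 ->
  (forall r t t' z, 0 < r -> g (cyl_point r t z) = g (cyl_point r t' z)) ->
  - x 0 1 * partial 0 g x + x 0 0 * partial 1 g x = 0.
Proof.
move=> sg /polarP[r [t [r0 x0E x1E]]] gconst.
have xE : x = cyl_point r t (x 0 2).
  by apply/rowP; apply: ord3P; rewrite !mxE.
have := rotation_derivative sg (fun s => gconst r s t (x 0 2) r0).
by rewrite -xE -x0E -x1E.
Qed.

(** A point of the axis moved slightly along the first coordinate leaves the axis, so continuity
    carries the vanishing over. *)
Lemma off_axis_dense g : continuous g ->
  (forall x, x 0 0 ^+ 2 + x 0 1 ^+ 2 != 0 -> g x = 0) -> forall x, g x = 0.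
Proof.
move=> cg goff x.
have [xaxis|] := eqVneq (x 0 0 ^+ 2 + x 0 1 ^+ 2) 0; last exact: goff.
apply/eqP; rewrite -normr_eq0 eq_le normr_ge0 andbT.
apply/ler_addgt0Pl => e e0; rewrite addr0.
have [d d0 gd] := continuous_ball (cg x) e0.
pose v : 'rV[R]_3 := delta_mx 0 0.
have n1 : 0 < `|v| + 1 by rewrite ltr_wpDl.
pose t := d / (`|v| + 1).
have t0 : 0 < t by rewrite divr_gt0.
have x00 : x 0 0 = 0.
  by apply/eqP; rewrite -sqrf_eq0 eq_le sqr_ge0 andbT -xaxis lerDl sqr_ge0.
have x01 : x 0 1 = 0.
  by apply/eqP; rewrite -sqrf_eq0 eq_le sqr_ge0 andbT -xaxis lerDr sqr_ge0.
have := gd (x + t *: v); rewrite [x + _]addrC addrK goff.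
  rewrite sub0r normrN => h; apply/ltW/h.
  rewrite (normrZ t) (gtr0_norm t0) /t -mulrA gtr_pMr// mulrC.
  by rewrite ltr_pdivrMr// mul1r ltrDl.
rewrite !mxE /= x00 x01 !addr0 mulr1 mulr0 expr0n addr0.
by rewrite sqrf_eq0 gt_eqF.
Qed.

(** The cylindrical frame is orthonormal at every angle. *)
Lemma dot_cyl (a b c a' b' c' t : R) :
  dot (a *: e_r t + b *: e_theta t + c *: e_z R)
      (a' *: e_r t + b' *: e_theta t + c' *: e_z R) = a * a' + b * b' + c * c'.
Proof.
rewrite /dot sum3E !mxE /=.
by ring: (sin2cos2 t).
Qed.

Lemma swirl_transport (u h : 'rV[R]_3 -> 'rV[R]_3) (ur ut uz ht : R -> R -> R) :
  smooth_field u -> smooth_field h ->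
  axisymmetric_with u ur ut uz ->
  axisymmetric_with h (fun _ _ => 0) ht (fun _ _ => 0) ->
  forall x, advect h (fun y => dot (u y) (h y)) x = 0.
Proof.
move=> su sh au ah.
have sg : smooth (fun y => dot (u y) (h y)).
  by apply: smooth_sum => k; exact: (smoothM (su k) (sh k)).
apply: off_axis_dense.
  apply: smooth_continuous; apply: smooth_sum => k.
  exact: (smoothM (sh k) (smooth_partial k sg)).
move=> x /[dup] xoff /polarP[r [t [r0 x0E x1E]]].
have xE : x = cyl_point r t (x 0 2).
  by apply/rowP; apply: ord3P; rewrite !mxE.
have := e_theta_derivative sg xoff; rewrite /advect sum3E.
move: (partial 0 _ x) (partial 1 _ x) (partial 2 _ x) => p0 p1 p2 H.
have {}H : - x 0 1 * p0 + x 0 0 * p1 = 0.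
  by apply: H => r' t1 t2 z r'0; rewrite !au// !ah// !dot_cyl.
have hx := ah r t (x 0 2) r0; rewrite -xE in hx; rewrite hx !mxE /=.
(* Multiplying by [r] turns the components of [e_theta] into [- x 0 1] and [x 0 0], which match
   [H]. *)
apply: (mulfI (lt0r_neq0 r0)).
transitivity (ht r (x 0 2) * (- x 0 1 * p0 + x 0 0 * p1)).
  by rewrite x0E x1E; ring.
by rewrite H !mulr0.
Qed.

End Axisymmetry.

(** * Laplacians of the pressure and of the head pressure *)

Section HeadPressure.
Set Implicit Arguments.
Unset Strict Implicit.
Context {R : realType}.
Variables (u h : 'rV[R]_3 -> 'rV[R]_3) (p : 'rV[R]_3 -> R).
Hypotheses (su : smooth_field u) (sh : smooth_field h) (sp : smooth p).

(** Partial derivatives commute, so this is the Laplacian of the divergence; it removes viscosity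
    from the pressure equation. *)
Lemma laplacian_partial_divergence (w : 'rV[R]_3 -> 'rV[R]_3) x :
  smooth_field w -> (forall y, divergence w y = 0) ->
  \sum_(k < 3) partial k (laplacian (component w k)) x = 0.
Proof.
move=> sw div0.
have divE : divergence w = fun=> 0 by apply/funext.
transitivity (laplacian (divergence w) x); last first.
  by rewrite divE /laplacian big1// => k _; rewrite !partial_cst.
have sdw k : smooth (partial k (component w k)) by apply/smooth_partial/sw.
transitivity (\sum_(k < 3) \sum_(j < 3)
    partial j (partial j (partial k (component w k))) x).
  apply: eq_bigr => k _; rewrite /laplacian.
  have sddw j := smooth_partial j (smooth_partial j (sw k)).
  rewrite (partial_sum k sddw); apply: eq_bigr => j _.
  by rewrite (partialC k j (smooth_partial j (sw k))) (partialC k j (sw k)).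
rewrite exchange_big /laplacian /divergence; apply: eq_bigr => j _.
by rewrite (partial_sum j sdw) (partial_sum j (fun k => smooth_partial j (sdw k))).
Qed.

(** By the product rule the second-order terms regroup into the advection of [divergence w], which
    is zero. *)
Lemma divergence_advect (w : 'rV[R]_3 -> 'rV[R]_3) x :
  smooth_field w -> (forall y, divergence w y = 0) ->
  \sum_(k < 3) partial k (advect w (component w k)) x =
  \sum_(k < 3) \sum_(j < 3)
    partial k (component w j) x * partial j (component w k) x.
Proof.
move=> sw div0.
have divE : divergence w = fun=> 0 by apply/funext.
have sdw i j : smooth (partial i (component w j)) by apply/smooth_partial/sw.
transitivity (\sum_(k < 3) \sum_(j < 3)
   (w x 0 j * partial k (partial j (component w k)) x +
    partial k (component w j) x * partial j (component w k) x)).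
  apply: eq_bigr => k _.
  rewrite /advect (partial_sum k (fun j => smoothM (sw j) (sdw j k))).
  by apply: eq_bigr => j _; exact: (partialM k x (sw j) (sdw j k)).
under eq_bigr do rewrite big_split/=.
rewrite big_split/= exchange_big/= big1 ?add0r// => j _.
rewrite -mulr_sumr.
have -> : \sum_(k < 3) partial k (partial j (component w k)) x =
    partial j (divergence w) x.
  rewrite /divergence (partial_sum j (fun k => sdw k k)).
  by apply: eq_bigr => k _; rewrite (partialC k j (sw k)).
by rewrite divE partial_cst mulr0.
Qed.

Hypothesis mhd : steady_MHD u h p.

(** Divergence of the momentum equation, in which only products of first derivatives survive. *)
Lemma laplacian_pressure x :
  laplacian p x = \sum_(k < 3) \sum_(j < 3)
    (partial k (component h j) x * partial j (component h k) x -
     partial k (component u j) x * partial j (component u k) x).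
Proof.
have divu y : divergence u y = 0 by have [] := mhd y.
have divh y : divergence h y = 0 by have [] := mhd y.
have sadv (w : 'rV[R]_3 -> 'rV[R]_3) k :
    smooth_field w -> smooth (advect w (component w k)).
  move=> sw; apply: smooth_sum => j.
  exact: (smoothM (sw j) (smooth_partial j (sw k))).
have slap k : smooth (laplacian (component u k)).
  by apply: smooth_sum => j; exact/smooth_partial/smooth_partial/su.
have momentum k : partial k (partial k p) x =
    partial k (advect h (component h k)) x +
    partial k (laplacian (component u k)) x -
    partial k (advect u (component u k)) x.
  have E : (fun y => advect h (component h k) y + laplacian (component u k) y) =
           (fun y => advect u (component u k) y + partial k p y).
    apply/funext => y.
    by have [/rowP/(_ k) + _ _ _] := mhd y; rewrite !mxE => ->.
  have := partialD k x (sadv h k sh) (slap k).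
  rewrite E (partialD k x (sadv u k su) (smooth_partial k sp)) => <-.
  by rewrite [X in X - _]addrC addrK.
transitivity (\sum_(k < 3) partial k (advect h (component h k)) x +
    \sum_(k < 3) partial k (laplacian (component u k)) x -
    \sum_(k < 3) partial k (advect u (component u k)) x).
  by rewrite -big_split -sumrB; apply: eq_bigr => k _; exact: momentum.
rewrite [X in _ + X - _](laplacian_partial_divergence x su divu) addr0.
rewrite [X in X - _](divergence_advect x sh divh).
rewrite [X in _ - X](divergence_advect x su divu) -sumrB.
by apply: eq_bigr => k _; rewrite -sumrB.
Qed.

(** Removes the square root, which is not differentiable at 0, so that the product rule applies. *)
Lemma total_headE : total_head u h p = fun x =>
  2^-1 * (dot (u x) (u x) + dot (h x) (h x)) + p x.
Proof.
have dot_ge0 (y : 'rV[R]_3) : 0 <= dot y y by apply: sumr_ge0 => i _; exact: sqr_ge0.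
by apply/funext => x; rewrite /total_head /enorm !sqr_sqrtr.
Qed.

Lemma smooth_dot (v w : 'rV[R]_3 -> 'rV[R]_3) : smooth_field v -> smooth_field w ->
  smooth (fun x => dot (v x) (w x)).
Proof. by move=> sv sw; apply: smooth_sum => k; exact: (smoothM (sv k) (sw k)). Qed.

Lemma partial_dot (v w : 'rV[R]_3 -> 'rV[R]_3) i x :
  smooth_field v -> smooth_field w ->
  partial i (fun y => dot (v y) (w y)) x =
  \sum_(j < 3) (v x 0 j * partial i (component w j) x +
                partial i (component v j) x * w x 0 j).
Proof.
move=> sv sw; rewrite /dot (partial_sum i (fun k => smoothM (sv k) (sw k))).
by apply: eq_bigr => j _; exact: (partialM i x (sv j) (sw j)).
Qed.

Lemma smooth_total_head : smooth (total_head u h p).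
Proof.
rewrite total_headE; apply: (smoothD _ sp); apply: smoothZ.
by apply: smoothD; exact: smooth_dot.
Qed.

Lemma partial_total_head i : partial i (total_head u h p) = fun x =>
  \sum_(j < 3) (u x 0 j * partial i (component u j) x +
                h x 0 j * partial i (component h j) x) + partial i p x.
Proof.
apply/funext => x; rewrite total_headE.
have suu := smooth_dot su su; have shh := smooth_dot sh sh.
rewrite (partialD i x (smoothZ 2^-1 (smoothD suu shh)) sp).
rewrite (partialZ 2^-1 i x (smoothD suu shh)) (partialD i x suu shh).
rewrite !partial_dot// -big_split mulr_sumr; congr (_ + _).
by apply: eq_bigr => j _ /=; field.
Qed.

(** The product rule used twice, grouped so that the Laplacians of the components appear as blocks
    which the equations can replace. *)
Lemma laplacian_total_head x : laplacian (total_head u h p) x =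
  \sum_(j < 3) (u x 0 j * laplacian (component u j) x +
                h x 0 j * laplacian (component h j) x) +
  \sum_(k < 3) \sum_(j < 3) (partial k (component u j) x ^+ 2 +
                             partial k (component h j) x ^+ 2) + laplacian p x.
Proof.
have sdu i j : smooth (partial i (component u j)) by apply/smooth_partial/su.
have sdh i j : smooth (partial i (component h j)) by apply/smooth_partial/sh.
transitivity (\sum_(k < 3) (\sum_(j < 3)
    (u x 0 j * partial k (partial k (component u j)) x +
     h x 0 j * partial k (partial k (component h j)) x) +
    \sum_(j < 3) (partial k (component u j) x ^+ 2 +
                  partial k (component h j) x ^+ 2) + partial k (partial k p) x)).
  apply: eq_bigr => k _; rewrite partial_total_head.
  have sujk j := smoothM (su j) (sdu k j); have shjk j := smoothM (sh j) (sdh k j).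
  have s1 j := smoothD (sujk j) (shjk j).
  rewrite (partialD k x (smooth_sum s1) (smooth_partial k sp)) -big_split.
  congr (_ + _); rewrite (partial_sum k s1); apply: eq_bigr => j _ /=.
  rewrite (partialD k x (sujk j) (shjk j)).
  rewrite (partialM k x (su j) (sdu k j)) (partialM k x (sh j) (sdh k j)).
  by rewrite -!expr2 addrACA.
rewrite !big_split/= exchange_big/=; congr (_ + _ + _).
by rewrite -big_split; apply: eq_bigr => j _; rewrite big_split/= !mulr_sumr.
Qed.

(* The velocity contributes the squared vorticity, the magnetic field the
   squared norm of its symmetrized gradient. *)
Lemma total_head_identity x :
  advect u (total_head u h p) x - laplacian (total_head u h p) x =
  advect h (fun y => dot (u y) (h y)) x -
  2^-1 * \sum_(k < 3) \sum_(j < 3)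
    ((partial k (component u j) x - partial j (component u k) x) ^+ 2 +
     (partial k (component h j) x + partial j (component h k) x) ^+ 2).
Proof.
have [mom _ ind _] := mhd x.
have lapu k : laplacian (component u k) x =
    \sum_(j < 3) (u x 0 j * partial j (component u k) x) + partial k p x -
    \sum_(j < 3) (h x 0 j * partial j (component h k) x).
  by move/rowP/(_ k): mom; rewrite !mxE /advect => ->;
    rewrite [X in X - _]addrC addrK.
have laph k : laplacian (component h k) x =
    \sum_(j < 3) (u x 0 j * partial j (component h k) x) -
    \sum_(j < 3) (h x 0 j * partial j (component u k) x).
  by move/rowP/(_ k): ind; rewrite !mxE /advect => ->.
rewrite laplacian_total_head laplacian_pressure /advect.
under eq_bigr do rewrite partial_total_head.
under [in RHS]eq_bigr do rewrite partial_dot//.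
under [in X in _ - (X + _ + _)]eq_bigr do rewrite lapu laph.
exact: (head_algebra (u x 0) (h x 0) (fun k => partial k p x)
  (fun k j => partial k (component u j) x) (fun k j => partial k (component h j) x)).
Qed.

End HeadPressure.

Theorem lemma3p2 (R : realType) (u h : 'rV[R]_3 -> 'rV[R]_3)
    (p : 'rV[R]_3 -> R) (ur ut uz ht : R -> R -> R)
    (smooth_u : smooth_field u) (smooth_h : smooth_field h)
    (smooth_p : smooth p)
    (mhd : steady_MHD u h p)
    (u_infty : vanishes_at_infinity u) (h_infty : vanishes_at_infinity h)
    (axi_u : axisymmetric_with u ur ut uz)
    (axi_h : axisymmetric_with h (fun _ _ => 0) ht (fun _ _ => 0)) :
  let Phi := total_head u h p in
  (forall x : 'rV[R]_3, advect u Phi x - laplacian Phi x <= 0) /\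
  (forall D : set 'rV[R]_3,
    open D -> connected D -> D !=set0 -> bounded_set D ->
    exists MD MdD : R,
      [/\ is_max (closure D) Phi MD, is_max (boundary D) Phi MdD & MD <= MdD]).
Proof.
have sub x : advect u (total_head u h p) x - laplacian (total_head u h p) x <= 0.
  (* Once the swirl term vanishes, minus half a sum of squares is left. *)
  rewrite total_head_identity// (swirl_transport smooth_u smooth_h axi_u axi_h).
  rewrite sub0r oppr_le0 mulr_ge0// sumr_ge0// => k _; apply: sumr_ge0 => j _.
  by rewrite addr_ge0 ?sqr_ge0.
split=> // D oD _ D0 bD.
exact: (weak_maximum_principle (smooth_total_head smooth_u smooth_h smooth_p)
  (smooth_continuous (smooth_u 0)) sub oD D0 bD).
Qed.
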